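(* Let $\mathcal K_0=\mathcal K_2^+$ with $\leqslant\,=\,\leqslant_2$, and let $\mathbf M_0$ be the $(\mathcal K_0,\leqslant)$-generic structure. There are $A,B\in\mathcal K_0$ with $A\leqslant B$ and $|\binom{B}{A}|=6$ such that $(A;B)$ is a tree-pair. Consequently, $\mathrm{Aut}(\mathbf M_0)$ does not have the convex $\leqslant$-Ramsey property with respect to $(\mathcal K_0,\leqslant)$.
   Context: Structures are finite graphs (language with one binary relation $\mathfrak R$). $\delta(A)=2|V(A)|-|E(A)|$; $A\leqslant B$ iff $\delta(C)\geq\delta(A)$ for all $A\subseteq C\subseteq B$; $\mathcal K_0$ is the class of finite graphs all of whose subgraphs $B$ satisfy $\delta(B)\geq0$ (a smooth class with free amalgamation and the hereditary property). For an infinite graph $N$, $A\leqslant N$ means $A\leqslant B$ for all finite $B\subseteq N$ containing $A$; $\binom{N}{A}$ is the set of embeddings $\Gamma:A\to N$ with $\Gamma[A]\leqslant N$. $\mathbf M_0$ is the unique countable graph with age $\mathcal K_0$, union of a chain $A_0\leqslant A_1\leqslant\cdots$ in $\mathcal K_0$, such that for finite $A\leqslant\mathbf M_0$ and $A\leqslant B\in\mathcal K_0$ some embedding of $B$ into $\mathbf M_0$ over $A$ has image $\leqslant\mathbf M_0$. A $\leqslant$-closed copy of $A$ is $\Gamma[A]$ for some $\Gamma\in\binom{\mathbf M_0}{A}$. For $m\geq2$, $\Lambda,\Lambda'\in\binom{\mathbf M_0}{B}$ lie on an $m$-cycle over $A$ if there are distinct $\Lambda_1=\Lambda,\dots,\Lambda_m=\Lambda'$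 in $\binom{\mathbf M_0}{B}$ with $\Lambda_1[B]\cap\Lambda_m[B]$ and all $\Lambda_j[B]\cap\Lambda_{j+1}[B]$ ($j<m$) containing a $\leqslant$-closed copy of $A$, and no two of these intersections containing a common $\leqslant$-closed copy of $A$. $(A;B)$ is a tree-pair if any two distinct $\Lambda,\Lambda'\in\binom{\mathbf M_0}{B}$ have $\Lambda[B]\cap\Lambda'[B]$ containing at most one $\leqslant$-closed copy of $A$ and never lie on an $l$-cycle, $l\geq2$. With $\langle{N\atop A}\rangle$ the finitely supported probability measures on $\binom{N}{A}$, $\langle{\mathtt r\atop A}\rangle$ (for $\mathtt r\in\langle{\mathbf M_0\atop B}\rangle$) the set of $\mathtt q\in\langle{\mathbf M_0\atop A}\rangle$ such that some $\mathtt p'\in\langle{B\atop A}\rangle$ gives $\mathtt q(\Lambda\circ\Gamma)=\mathtt r(\Lambda)\mathtt p'(\Gamma)$ for all $\Gamma\in\binom{B}{A},\Lambda\in\binom{\mathbf M_0}{B}$, and $f(\mathtt q)=\sum_\Gamma f(\Gamma)\mathtt q(\Gamma)$: $\mathrm{Aut}(\mathbf M_0)$ has the convex $\leqslant$-Ramsey property w.r.t. $(\mathcal K_0,\leqslant)$ if for all $A\leqslant B$ in $\mathcal K_0$ and $f:\binom{\mathbf M_0}{A}\to\{0,1\}$ there is $\mathtt p\in\langle{\mathbf M_0\atop B}\rangle$ with $|f(\mathtt q_1)-f(\mathtt q_2)|\leq\frac12$ for all $\mathtt q_1,\mathtt q_2\in\langle{\mathtt p\atop A}\rangle$.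
   Formalization: The relation q(Λ∘Γ)=r(Λ)p'(Γ) is read as q(h)=sum of r(Λ)p'(Γ) over all pairs with Λ∘Γ=h; read pointwise no such q exists for A≠B and the claim fails. The intersections of an m-cycle are counted by position, so no 2-cycles exist. *)

(* Defs.v *)
From HB Require Import structures.
From mathcomp Require Import all_boot all_order all_algebra.
From mathcomp Require Import finmap.
From mathcomp Require Import boolp classical_sets functions cardinality reals.

Set Implicit Arguments.
Unset Strict Implicit.
Unset Printing Implicit Defensive.

Import Order.TTheory GRing.Theory Num.Theory.
Local Open Scope fset_scope.
Local Open Scope ring_scope.

Record sgraph (V : Type) := SGraph {
  adj :> rel V;
  adj_sym : symmetric adj;
  adj_irr : irreflexive adj }.

(* Substructures are induced subgraphs. A finite substructure is represented
   by its vertex set S : {fset V}; S coerces to a finType, so that [induced G S]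
   is the same substructure as a finite graph in its own right. *)
Definition induced (V : choiceType) (G : sgraph V) (S : {fset V}) : sgraph S :=
  @SGraph S (fun x y => G (val x) (val y))
    (fun x y => adj_sym G (val x) (val y)) (fun x => adj_irr G (val x)).

Section Predimension.
Variables (V : choiceType) (G : sgraph V).
Implicit Types A B C S : {fset V}.

Definition edges S : {fset {fset V}} :=
  [fset [fset x; y] | x in S, y in S & G x y].

Definition delta S : int := (2 * #|` S|)%:Z - #|` edges S|%:Z.

Definition strong A B : Prop :=
  A `<=` B /\ forall C, A `<=` C -> C `<=` B -> delta A <= delta C.

(* On a finite graph this is [strong A] of the full vertex set, since
   [strong A B] is inherited by every B' with A `<=` B' `<=` B. *)
Definition closed_in A : Prop := forall B, A `<=` B -> strong A B.

End Predimension.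

Definition K0 (V : finType) (G : sgraph V) : Prop :=
  forall S : {fset V}, 0 <= delta G S.

Section Embeddings.
Variables (V : finType) (W : choiceType) (A : sgraph V) (N : sgraph W).

Definition embedding (g : {ffun V -> W}) : Prop :=
  injective g /\ forall x y, N (g x) (g y) = A x y.

Definition img (g : {ffun V -> W}) : {fset W} := [fset g x | x : V].

Definition binom : set {ffun V -> W} :=
  fun g => embedding g /\ closed_in N (img g).

Definition closed_copy (C : {fset W}) : Prop :=
  exists2 g : {ffun V -> W}, binom g & C = img g.

End Embeddings.

Definition generic (T : countType) (M : sgraph T) : Prop :=
  [/\ (forall (V : finType) (G : sgraph V),
         K0 G <-> exists g : {ffun V -> T}, embedding G M g),
      (exists Ch : nat -> {fset T},
         [/\ forall n, K0 (induced M (Ch n)),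
             forall n, strong M (Ch n) (Ch n.+1)
           & forall x, exists n, x \in Ch n])
    & (forall (V : finType) (B : sgraph V) (A : {fset V}),
         K0 B -> closed_in B A ->
         forall g : {ffun A -> T}, binom (induced B A) M g ->
         exists2 h : {ffun V -> T}, binom B M h &
           forall x : A, h (val x) = g x)].

Section TreePair.
Variables (T : choiceType) (M : sgraph T).
Variables (VA VB : finType) (A : sgraph VA) (B : sgraph VB).
Implicit Types L : {ffun VB -> T}.

Definition cap L L' : {fset T} := img L `&` img L'.

(* The members of the cycle are c 0, ..., c m.-1. Its m intersections are
   counted by their index, not as sets: for m = 2 the two of them are the same
   set, so there is no 2-cycle. *)
Definition on_cycle (m : nat) L L' : Prop :=
  exists c : nat -> {ffun VB -> T},
    let I i := cap (c i) (c (i.+1 %% m)%N) in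
    [/\ c 0%N = L /\ c m.-1 = L',
        forall i, (i < m)%N -> binom B M (c i),
        forall i j, (i < m)%N -> (j < m)%N -> c i = c j -> i = j,
        forall i, (i < m)%N -> exists2 C, closed_copy A M C & C `<=` I i
      & forall i j, (i < m)%N -> (j < m)%N -> i <> j ->
          ~ exists C, [/\ closed_copy A M C, C `<=` I i & C `<=` I j]].

Definition tree_pair : Prop :=
  forall L L', binom B M L -> binom B M L' -> L <> L' ->
    (forall C C', closed_copy A M C -> closed_copy A M C' ->
       C `<=` cap L L' -> C' `<=` cap L L' -> C = C') /\
    (forall l, (2 <= l)%N -> ~ on_cycle l L L').

End TreePair.

Section ConvexRamsey.
Variable R : realType.

Definition fsmeas (V : finType) (W : choiceType) (A : sgraph V) (N : sgraph W)
    (p : {fsfun {ffun V -> W} -> R with 0}) : Prop :=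
  [/\ forall g, g \in finsupp p -> binom A N g,
      forall g, 0 <= p g
    & \sum_(g <- finsupp p) p g = 1].

Definition expect (K : choiceType) (f : K -> bool) (q : {fsfun K -> R with 0})
  : R := \sum_(g <- finsupp q) (f g)%:R * q g.

(* q is the law of L \o g, for L of law r and g of law p' independent: the mass
   r L * p' g is carried by L \o g, and the masses of the pairs (L, g) with the
   same composite are added. *)
Definition submeas (T : choiceType) (VA VB : finType) (M : sgraph T)
    (A : sgraph VA) (B : sgraph VB)
    (r : {fsfun {ffun VB -> T} -> R with 0})
    (q : {fsfun {ffun VA -> T} -> R with 0}) : Prop :=
  fsmeas A M q /\
  exists2 p' : {fsfun {ffun VA -> VB} -> R with 0}, fsmeas A B p' &
    forall h : {ffun VA -> T},
      q h = \sum_(L <- finsupp r)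
              \sum_(g <- finsupp p' | [ffun x => L (g x)] == h) r L * p' g.

Definition convex_ramsey (T : choiceType) (M : sgraph T) : Prop :=
  forall (V : finType) (B : sgraph V) (A : {fset V}),
    K0 (induced B A) -> K0 B -> closed_in B A ->
    forall f : {ffun A -> T} -> bool,
    exists2 p : {fsfun {ffun V -> T} -> R with 0}, fsmeas B M p &
      forall q1 q2, submeas M (induced B A) B p q1 ->
        submeas M (induced B A) B p q2 ->
        `|expect f q1 - expect f q2| <= 1 / 2.

End ConvexRamsey.

(* Main.v *)
(* A is a single vertex and B is a rigid graph on 11 vertices with delta B =
   2 in which exactly 6 vertices are closed and every proper subset
   containing two of these has predimension > 2. Hence a closed subset of M
   meeting a closed copy of B in two closed points contains that copy. Since
   delta A = delta B, a finite closed set together with a copy of B sharing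
   a closed point with it is again closed, so unions of consecutively
   attached copies are closed, and each new copy meets the previous ones in
   one closed point only: the copies form a forest. In a forest the points
   can be coloured so that every copy has at most one deviation from the
   pattern 1,1,1,0,0,0 on its closed points; for a measure p on the copies,
   the expected colours F_0, ..., F_5 of the six points then satisfy (F_0 -
   F_3) + (F_1 - F_4) + (F_2 - F_5) >= 2, so one of the differences exceeds
   1/2. *)

Require Import Defs.
From mathcomp Require Import all_boot all_order all_algebra.
From mathcomp Require Import finmap.
From mathcomp Require Import boolp classical_sets functions cardinality reals.
From mathcomp Require Import filter zify lra.

Set Implicit Arguments.
Unset Strict Implicit.
Unset Printing Implicit Defensive.

Import Order.TTheory GRing.Theory Num.Theory.
Local Open Scope fset_scope.
Local Open Scope ring_scope.

(** * Predimension and closed sets *)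

Section Closed.
Variables (V : choiceType) (G : sgraph V).
Implicit Types (A B C S X Y : {fset V}) (x y : V).

Lemma edgesP S e :
  reflect (exists x y, [/\ x \in S, y \in S, G x y & e = [fset x; y]])
          (e \in edges G S).
Proof.
apply: (iffP (imfset2P _ _ _ _ _)) => [[x xS [y]]|[x [y [xS yS Gxy ->]]]].
  by rewrite inE => /andP[yS Gxy] ->; exists x, y.
by exists x => //; exists y => //; rewrite inE yS.
Qed.

Lemma edges_sub S X : S `<=` X -> edges G S `<=` edges G X.
Proof.
move=> /fsubsetP sSX; apply/fsubsetP => e /edgesP[x [y [xS yS Gxy ->]]].
by apply/edgesP; exists x, y; split=> //; apply: sSX.
Qed.

(** Vertices are counted modularly, and an edge lying in both sets lies in the intersection; the
    slack comes from the edges of the union that lie in neither set. *)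
Lemma delta_submod X Y :
  delta G (X `|` Y) + delta G (X `&` Y) <= delta G X + delta G Y.
Proof.
have sU : edges G X `|` edges G Y `<=` edges G (X `|` Y).
  by rewrite fsubUset !edges_sub ?fsubsetUl ?fsubsetUr.
have sI : edges G X `&` edges G Y `<=` edges G (X `&` Y).
  apply/fsubsetP => e; rewrite inE => /andP[/edgesP[x [y [xX yX Gxy ->]]]].
  case/edgesP => x' [y' [x'Y y'Y _ exy]]; apply/edgesP; exists x, y.
  have inY z : z \in [fset x; y] -> z \in Y.
    by rewrite exy !inE => /orP[] /eqP->.
  by split; rewrite ?inE ?xX ?yX // inY // !inE eqxx ?orbT.
have := cardfsUI X Y; have := cardfsUI (edges G X) (edges G Y).
by move/fsubset_leq_card: sU; move/fsubset_leq_card: sI; rewrite /delta; lia.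
Qed.

Lemma closed_inI X Y : closed_in G X -> closed_in G Y -> closed_in G (X `&` Y).
Proof.
move=> clX clY B sB; split=> // C sXYC _.
(* delta (X /\ Y) <= delta (C /\ X) <= delta C, each by submodularity. *)
have [_ /(_ (X `|` C))] := clX (X `|` C) (fsubsetUl _ _).
rewrite fsubsetUl fsubset_refl => /(_ isT isT) hX.
have [_ /(_ (Y `|` (X `&` C)))] := clY (Y `|` (X `&` C)) (fsubsetUl _ _).
rewrite fsubsetUl fsubset_refl => /(_ isT isT) hY.
have := delta_submod X C; have := delta_submod Y (X `&` C).
have -> : Y `&` (X `&` C) = X `&` Y.
  rewrite fsetICA fsetIA; apply/fsetIidPl; exact: sXYC.
lia.
Qed.

Lemma closed_in_delta A C : closed_in G A -> A `<=` C -> delta G A <= delta G C.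
Proof. by move=> clA sAC; have [_] := clA _ sAC; apply. Qed.

Lemma closed_in_extend A C :
  closed_in G A -> A `<=` C -> delta G C <= delta G A -> closed_in G C.
Proof.
move=> clA sAC le B sCB; split=> // D sCD _; apply: (le_trans le).
exact: (closed_in_delta clA (fsubset_trans sAC sCD)).
Qed.

Lemma delta1 x : delta G [fset x] = 2.
Proof.
rewrite /delta cardfs1; suff -> : edges G [fset x] = fset0 by rewrite cardfs0.
apply/fsetP=> e; rewrite inE; apply/edgesP => -[a [b []]].
by rewrite !inE => /eqP-> /eqP->; rewrite adj_irr.
Qed.

End Closed.

(** * Embeddings and transport of closedness *)

Section Embedding.
Variables (V : finType) (W : choiceType) (A : sgraph V) (N : sgraph W).
Variable (g : {ffun V -> W}).
Implicit Types (S : {fset V}).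

Lemma delta_embedding S :
  embedding A N g -> delta N [fset g x | x in S] = delta A S.
Proof.
case=> g_inj gE; rewrite /delta card_imfset //; congr (_ - Posz _).
have -> : edges N [fset g x | x in S]
        = [fset [fset g x | x in e : {fset V}] | e in edges A S].
  apply/fsetP=> e; apply/edgesP/imfsetP => /=.
    case=> _ [_ [/imfsetP[x xS ->] /imfsetP[y yS ->] Nxy ->]].
    exists [fset x; y]; last by rewrite imfset_fset2.
    by apply/edgesP; exists x, y; rewrite -gE.
  case=> _ /edgesP[x [y [xS yS Axy ->]]] ->; exists (g x), (g y).
  by rewrite !in_imfset //= gE imfset_fset2.
rewrite card_imfset //= => e e' eq_ge; apply/fsetP=> x.
have memE (E : {fset V}) : (x \in E) = (g x \in [fset g z | z in E]).
  by rewrite mem_imfset.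
by rewrite !memE eq_ge.
Qed.

Lemma imgP y : reflect (exists x, y = g x) (y \in img g).
Proof. by apply: (iffP (imfsetP _ _ _ _)) => -[x]; [exists x|exists x]. Qed.

Lemma mem_img x : g x \in img g.
Proof. by apply/imgP; exists x. Qed.

Lemma fsetI_img D : D `&` img g = [fset g z | z in [fset z : V | g z \in D]].
Proof.
apply/fsetP=> t; rewrite inE; apply/andP/imfsetP => /= [[tD /imgP[z tz]]|].
  by exists z; rewrite // !inE -tz.
by case=> z; rewrite !inE /= => zD ->; rewrite zD mem_img.
Qed.

(** Transitivity of closedness: cutting a superset [C] down to the closed set [img g] does not
    increase [delta], and what remains is the image of a superset of [S]. *)
Lemma closed_in_imfset S :
  binom A N g -> closed_in A S -> closed_in N [fset g x | x in S].
Proof.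
move=> [ge clg] clS D sD; split=> // C sC _.
apply: (@le_trans _ _ (delta N (C `&` img g))); last first.
  have := delta_submod N C (img g).
  by have := closed_in_delta clg (fsubsetUr C (img g)); lia.
rewrite fsetI_img !(delta_embedding _ ge); apply: (closed_in_delta clS).
apply/fsubsetP=> x xS; rewrite !inE /=.
by apply: (fsubsetP sC); rewrite in_imfset.
Qed.

End Embedding.

Lemma binom_comp (U V : finType) (W : choiceType) (A : sgraph U) (B : sgraph V)
    (N : sgraph W) (g : {ffun U -> V}) (h : {ffun V -> W}) :
  binom A B g -> binom B N h -> binom A N [ffun x => h (g x)].
Proof.
move=> [[g_inj gE] clg] bh; have [[h_inj hE] _] := bh; split.
  split=> [x y|x y]; rewrite !ffunE; first by move=> /h_inj/g_inj.
  by rewrite hE gE.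
have -> : img [ffun x => h (g x)] = [fset h y | y in img g].
  apply/fsetP=> t; apply/imgP/imfsetP => /= [[x ->]|[y /imgP[x ->] ->]].
    by exists (g x); rewrite ?ffunE ?mem_img.
  by exists x; rewrite ffunE.
exact: (closed_in_imfset bh clg).
Qed.

Lemma K0_induced (V : finType) (G : sgraph V) (S : {fset V}) :
  K0 G -> K0 (induced G S).
Proof.
move=> KG X; have /delta_embedding <- : embedding (induced G S) G
    [ffun x : S => val x]; last exact: KG.
by split=> [x y|x y]; rewrite !ffunE //; exact: val_inj.
Qed.

Lemma fset1_sub_eq (K : choiceType) (v : K) (x : [fset v]) : x = [` fset11 v].
Proof. by apply: val_inj; apply/fset1P; exact: valP. Qed.

Lemma img_point (K W : choiceType) (v : K) (g : {ffun [fset v] -> W}) :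
  img g = [fset g [` fset11 v]].
Proof.
apply/fsetP=> t; rewrite inE; apply/imgP/eqP => [[x ->]|->].
  by rewrite (fset1_sub_eq x).
by exists [` fset11 v].
Qed.

(** A single vertex carries no edge, so every map from it is an embedding and only closedness of the
    image point is left. *)
Lemma binom_point (V : finType) (W : choiceType) (G : sgraph V) (N : sgraph W)
    v (g : {ffun [fset v] -> W}) :
  binom (induced G [fset v]) N g <-> closed_in N [fset g [` fset11 v]].
Proof.
rewrite -img_point; split=> [[]//|clg]; split=> //.
split=> [x y _|x y]; rewrite (fset1_sub_eq x) (fset1_sub_eq y) //.
by rewrite /= !adj_irr.
Qed.

(** * Measures induced by a fixed embedding *)

Section Dirac.
Variables (R : realType) (T : choiceType) (U V : finType).
Variables (M : sgraph T) (A : sgraph U) (B : sgraph V).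

(** With [p'] the point mass at [g], the induced measure is the pushforward of [p] under composition
    with [g]. This makes the expected colour at each fixed closed point available. *)
Lemma submeas_dirac (p : {fsfun {ffun V -> T} -> R with 0})
    (g : {ffun U -> V}) :
  fsmeas B M p -> binom A B g ->
  exists2 q, submeas M A B p q & forall f, expect f q =
    \sum_(L <- finsupp p) (f [ffun x => L (g x)])%:R * p L.
Proof.
move=> [pB p_ge0 p_sum] gB; pose cmp (L : {ffun V -> T}) := [ffun x => L (g x)].
pose I := [fset cmp L | L in finsupp p].
pose q : {fsfun {ffun U -> T} -> R with 0} :=
  [fsfun h in I => \sum_(L <- finsupp p | cmp L == h) p L | 0].
have qE h : q h = \sum_(L <- finsupp p | cmp L == h) p L.
  rewrite fsfunE; case: ifPn => // hI; rewrite big_seq_cond big1 //.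
  by move=> L /andP[Lp /eqP cL]; rewrite -cL in_imfset in hI.
have q_sub : finsupp q `<=` I.
  apply/fsubsetP=> h; rewrite mem_finsupp fsfunE.
  by case: ifP => //; rewrite eqxx.
have q_int (f : {ffun U -> T} -> R) : \sum_(h <- finsupp q) f h * q h
    = \sum_(L <- finsupp p) f (cmp L) * p L.
  rewrite (big_fset_incl _ q_sub); last first.
    by move=> h _; rewrite memNfinsupp => /eqP->; rewrite mulr0.
  rewrite [RHS](partition_big_imfset _ cmp); apply: eq_bigr => h _.
  by rewrite qE big_distrr; apply: eq_bigr => L /eqP->.
exists q; last by move=> f; exact: q_int (fun h => (f h)%:R).
split; [split|].
- move=> h /(fsubsetP q_sub)/imfsetP[L /= Lp ->].
  exact: binom_comp gB (pB _ Lp).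
- by move=> h; rewrite qE; apply: sumr_ge0.
- rewrite -[RHS]p_sum -[RHS](eq_bigr _ (fun L _ => mul1r (p L))).
  by rewrite -(q_int (fun=> 1)); apply: eq_bigr => h _; rewrite mul1r.
pose p' : {fsfun {ffun U -> V} -> R with 0} := [fsfun h in [fset g] => 1 | 0].
have p'g : p' g = 1 by rewrite fsfunE inE eqxx.
have supp_p' : finsupp p' = [fset g].
  apply/fsetP=> h; rewrite mem_finsupp fsfunE.
  by case: ifP => _; rewrite ?oner_eq0 ?eqxx.
exists p'; last first.
  move=> h; rewrite qE big_mkcond; apply: eq_bigr => L _.
  by rewrite supp_p' big_mkcond big_seq_fset1 p'g mulr1.
split.
- by move=> h; rewrite supp_p' => /fset1P->.
- by move=> h; rewrite fsfunE; case: ifP.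
- by rewrite supp_p' big_seq_fset1.
Qed.
End Dirac.

(** * Trees of copies of a graph of predimension 2 *)

Section PointTrees.
Variables (T : countType) (M : sgraph T).
Variables (V : finType) (B : sgraph V).
(** The six distinguished vertices turn out to be exactly the closed ones. The index type is written
    [3 + 3] so that sums over it split into the indices [i] below 3 and their partners [i + 3]. *)
Variable pts : 'I_(3 + 3) -> V.
Let good x := x \in codom pts.
Hypothesis pts_inj : injective pts.
Hypothesis delta_full : delta B [fset x | x : V] = 2.
Hypothesis good_delta : forall (S : {fset V}) x,
  x \in S -> good x -> 2 <= delta B S.
Hypothesis good2_delta : forall (S : {fset V}) x y,
  x \in S -> y \in S -> good x -> good y -> x != y ->
  (forall z, z \in S) \/ 2 < delta B S.
Hypothesis bad_delta : forall x, ~~ good x ->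
  exists2 S : {fset V}, x \in S & delta B S < 2.
Hypothesis rigid : forall s, embedding B B s -> s =1 id.
Implicit Types (L : {ffun V -> T}) (U D : {fset T}).

Let copy := binom B M.
Let pts_good i : good (pts i). Proof. exact: codom_f. Qed.
Let closedpt t := closed_in M [fset t].

Lemma closed_in1 x : closed_in B [fset x] <-> good x.
Proof.
split=> [clx|gx].
  apply: contraT => /bad_delta[S xS]; rewrite ltNge -(delta1 B x) => /negP[].
  by apply: (closed_in_delta clx); rewrite fsub1set.
move=> S sS; split=> // C sC _; rewrite delta1; apply: good_delta gx.
by rewrite -fsub1set.
Qed.

Lemma copy_delta L : copy L -> delta M (img L) = 2.
Proof.
case=> Le _; rewrite -delta_full -(delta_embedding _ Le); congr (delta M _).
apply/fsetP=> t; apply/imgP/imfsetP => /= [[x ->]|[x _ ->]]; exists x => //.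
by rewrite !inE.
Qed.

Lemma copy_closedpt L x : copy L -> closedpt (L x) <-> good x.
Proof.
move=> cL; have [Le clL] := cL; split=> [clx|gx].
  apply: contraT => /bad_delta[S xS].
  rewrite -(delta_embedding S Le) -(delta1 M (L x)) ltNge => /negP[].
  by apply: (closed_in_delta clx); rewrite fsub1set in_imfset.
by have /(closed_in_imfset cL) := (closed_in1 x).2 gx; rewrite imfset_fset1.
Qed.

(** The intersection of [D] with the copy is closed, so its predimension is at most that of the
    copy, namely 2. A proper part of the copy with two good points would exceed 2. *)
Lemma copy_sub L D t u : copy L -> closed_in M D ->
  closedpt t -> closedpt u -> t != u ->
  t \in D -> u \in D -> t \in img L -> u \in img L -> img L `<=` D.
Proof.
move=> cL clD clt clu neq tD uD /imgP[x tE] /imgP[y uE]; subst t u.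
have [Le clL] := cL.
have clDL := closed_inI clD clL.
pose S := [fset z : V | L z \in D].
have xS : x \in S by rewrite !inE.
have yS : y \in S by rewrite !inE.
have xy : x != y by apply: contra neq => /eqP->.
have [||allS|] := good2_delta xS yS _ _ xy; try exact/(copy_closedpt _ cL).
  by apply/fsubsetP => t /imgP[z ->]; have := allS z; rewrite !inE.
rewrite -(delta_embedding S Le) -fsetI_img -(copy_delta cL) ltNge => /negP[].
exact: closed_in_delta clDL (fsubsetIr _ _).
Qed.

(** [L] factors through [L'] by a self-embedding of [B], which is the identity by rigidity. Hence
    copies may be identified with their images. *)
Lemma copy_inj L L' : copy L -> copy L' -> img L `<=` img L' -> L = L'.
Proof.
move=> [[injL L_adj] _] [[injL' L'_adj] _] /fsubsetP sLL'.
have exs x : exists y, L x == L' y.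
  by have /imgP[y ->] := sLL' _ (mem_img L x); exists y.
pose s := [ffun x => xchoose (exs x)].
have sE x : L x = L' (s x) by rewrite ffunE; apply/eqP/(xchooseP (exs x)).
have s_id : s =1 id.
  apply: rigid; split=> [x y exy|x y].
  2: by rewrite -(L'_adj (s x) (s y)) -!sE L_adj.
  by apply: injL; rewrite !sE exy.
by apply/ffunP=> x; rewrite sE s_id.
Qed.

(** The intersection contains a closed point and so has predimension at least 2; by submodularity,
    adding the copy does not raise the predimension of [U]. *)
Lemma copy_extend U L t : copy L -> closed_in M U -> closedpt t ->
  t \in U -> t \in img L -> closed_in M (img L `|` U).
Proof.
move=> cL clU clt tU tL; apply: (closed_in_extend clU (fsubsetUr _ _)).
have := delta_submod M (img L) U; rewrite (copy_delta cL).
have : [fset t] `<=` img L `&` U by rewrite fsub1set inE tL.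
by move/(closed_in_delta clt); rewrite delta1; lia.
Qed.

(* Three points of L' are distributed over U and img L, so one of the two
   contains two of them. *)
Lemma copy_split U L L' : copy L -> copy L' -> closed_in M U ->
  img L' `<=` img L `|` U -> L' = L \/ img L' `<=` U.
Proof.
move=> cL cL' clU /fsubsetP sub; have [[_ clL] [[injL' _] _]] := (cL, cL').
pose pt k := pts (inord k).
have pt_neq i j : (i < j < 6)%N -> pt i != pt j.
  move=> ij; rewrite (inj_eq pts_inj) -val_eqE /= !inordK; lia.
have := (pts_good (inord 0), pts_good (inord 1), pts_good (inord 2)).
have := (pt_neq 0 1 isT, pt_neq 0 2 isT, pt_neq 1 2 isT)%N.
rewrite -/(pt 0%N) -/(pt 1%N) -/(pt 2%N).
move: (pt 0%N) (pt 1%N) (pt 2%N) => x y z [[xy xz] yz] [[gx gy] gz].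
have two D a b : closed_in M D -> good a -> good b -> a != b ->
    L' a \in D -> L' b \in D -> img L' `<=` D.
  move=> clD ga gb ab aD bD.
  apply: (copy_sub cL' clD _ _ _ aD bD); rewrite ?mem_img //.
  - exact/(copy_closedpt _ cL').
  - exact/(copy_closedpt _ cL').
  - by apply: contra ab => /eqP/injL'->.
have inL a b : good a -> good b -> a != b ->
    L' a \in img L -> L' b \in img L -> L' = L.
  by move=> ga gb ab La Lb; apply: copy_inj => //; exact: two ab La Lb.
have [] := (sub _ (mem_img L' x), sub _ (mem_img L' y)).
have := sub _ (mem_img L' z); rewrite !inE.
case/orP=> Hz; case/orP=> Hx; case/orP=> Hy.
all: by [left; apply: (inL x y)|left; apply: (inL x z)|left; apply: (inL y z)
        |right; apply: (two _ x y)|right; apply: (two _ x z)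
        |right; apply: (two _ y z)].
Qed.

(** * Towers of copies and the forest property *)

Fixpoint span (s : seq {ffun V -> T}) : {fset T} :=
  if s is L :: s' then img L `|` span s' else fset0.

(* Each copy of the list shares a closed point with the union of the copies
   after it. *)
Fixpoint tower (s : seq {ffun V -> T}) : Prop :=
  if s is L :: s' then
    copy L /\ if s' is [::] then True else
      tower s' /\ exists t, [/\ closedpt t, t \in img L & t \in span s']
  else True.

Lemma spanP s t : reflect (exists2 L, L \in s & t \in img L) (t \in span s).
Proof.
elim: s => [|L s IHs] /=; first by rewrite inE; apply: ReflectF => -[].
rewrite inE; apply: (iffP orP) => [[tL|/IHs[L' L's tL']]|[L']].
- by exists L; rewrite ?inE ?eqxx.
- by exists L'; rewrite ?inE ?L's ?orbT.
- rewrite inE => /orP[/eqP->|L's] tL; first by left.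
  by right; apply/IHs; exists L'.
Qed.

Lemma tower_closed L s : tower (L :: s) -> closed_in M (span (L :: s)).
Proof.
elim: s L => [|L' s IHs] L /= => [[[_ clL] _]|]; first by rewrite fsetU0.
move=> [cL [tw [t [clt tL ts]]]].
exact: (copy_extend cL (IHs _ tw) clt ts tL).
Qed.

(** Peeling copies off the tower with [copy_split] shows that the union of a tower contains no
    copies beyond those attached. *)
Lemma tower_mem s L : tower s -> copy L -> img L `<=` span s -> L \in s.
Proof.
move=> tw cL; elim: s tw => [_|L' s IHs].
  by move/fsubsetP/(_ _ (mem_img L (pts ord0))); rewrite inE.
case: s IHs => [|L'' s] IHs tw sub.
  have [cL' _] := tw; rewrite /= fsetU0 in sub.
  by rewrite (copy_inj cL cL' sub) mem_head.
have [cL' [tw' _]] := tw.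
have [->|sub'] := copy_split cL' cL (tower_closed tw') sub.
  exact: mem_head.
by rewrite inE IHs ?orbT.
Qed.

(** Two common closed points would pull the whole copy into the closed union, and then it would be a
    member of the tower. *)
Lemma tower_inter s L t u : tower s -> copy L -> L \notin s ->
  closedpt t -> closedpt u -> t \in img L -> u \in img L ->
  t \in span s -> u \in span s -> t = u.
Proof.
case: s => [|L' s] tw cL nLs clt clu tL uL ts us; first by rewrite inE in ts.
apply/eqP; apply: contraNT nLs => neq; apply: (tower_mem tw cL).
exact: (copy_sub cL (tower_closed tw) clt clu neq).
Qed.

Let joins L s :=
  L \notin s /\ exists t, [/\ closedpt t, t \in img L & t \in span s].

Lemma maximal_tower (F : seq {ffun V -> T}) : (forall L, L \in F -> copy L) ->
  F != [::] -> exists L s, [/\ tower (L :: s), uniq (L :: s),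
    {subset L :: s <= F} & forall L', L' \in F -> ~ joins L' (L :: s)].
Proof.
move=> cF; case: F cF => // L0 F0; set F := L0 :: F0 => cF _.
(* Copies are attached greedily. Since [s] omits the head [L], the bound [n = 0] already contradicts
   [L :: s] being a duplicate-free part of [F]. *)
suff ext n L s : (size F - size s <= n)%N -> tower (L :: s) -> uniq (L :: s) ->
    {subset L :: s <= F} -> exists L s, [/\ tower (L :: s), uniq (L :: s),
    {subset L :: s <= F} & forall L', L' \in F -> ~ joins L' (L :: s)].
  apply: (ext (size F) L0 [::]) => //.
    by split; first exact/cF/mem_head.
  by move=> L; rewrite inE => /eqP->; exact: mem_head.
elim: n L s => [|n IHn] L s sz tw us sub.
  by have := uniq_leq_size us sub; move: sz => /=; lia.
have [[L1 L1F [nL1 sh]]|nojoin] :=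
  pselect (exists2 L1, L1 \in F & joins L1 (L :: s)).
  apply: (IHn L1 (L :: s)).
  - have := uniq_leq_size us sub; move: sz => /=; lia.
  - by split; [exact: cF | split].
  - by rewrite cons_uniq nL1.
  - by move=> K; rewrite inE => /orP[/eqP->//|/sub].
by exists L, s; split=> // L' L'F j; apply: nojoin; exists L'.
Qed.

(** The leaf is the copy attached last to a maximal tower: by maximality every other copy of [F]
    meeting it in a closed point belongs to the rest of the tower, which it meets in at most one
    closed point. *)
Lemma exists_leaf (F : seq {ffun V -> T}) : (forall L, L \in F -> copy L) ->
  F != [::] -> exists2 L, L \in F & forall t u L' L'',
    closedpt t -> closedpt u -> t \in img L -> u \in img L ->
    L' \in F -> L'' \in F -> L' != L -> L'' != L ->
    t \in img L' -> u \in img L'' -> t = u.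
Proof.
move=> cF /(maximal_tower cF)[L [s [tw us sub nojoin]]].
have LF : L \in F by exact/sub/mem_head.
have inspan v K : closedpt v -> K \in F -> K != L -> v \in img L ->
    v \in img K -> v \in span s.
  move=> clv KF nKL vL vK; apply/spanP; exists K => //.
  apply: contraT => nKs; case: (nojoin K KF); split.
    by rewrite inE negb_or nKL.
  by exists v; rewrite /= inE vL.
exists L => // t u L' L'' clt clu tL uL L'F L''F nL' nL'' tL' uL''.
have tws : tower s by case: s tw {us sub nojoin inspan} => // K s [_ []].
apply: (tower_inter (s := s) (L := L)) => //.
- exact: cF.
- by case/andP: us.
- exact: (inspan _ L').
- exact: (inspan _ L'').
Qed.

Lemma closed_copy1 v C : closed_copy (induced B [fset v]) M C ->
  exists2 t, closedpt t & C = [fset t].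
Proof.
case=> g /binom_point clg ->; exists (g [` fset11 v]) => //.
exact: img_point.
Qed.

(** Two common closed points force equality of the copies. A cycle is excluded by opening it at
    [c 0]: the other members form a tower, which [c 0] meets in one closed point only. *)
Lemma point_tree_pair v : tree_pair M (induced B [fset v]) B.
Proof.
move=> L L' cL cL' neq; split=> [C C'|l l2 [c []]].
  move=> /closed_copy1[t clt ->] /closed_copy1[u clu ->].
  rewrite !fsub1set !inE => /andP[tL tL'] /andP[uL uL'].
  have [-> //|tu] := eqVneq t u; case: neq; apply: (copy_inj cL cL').
  by have [_ clL'] := cL'; exact: (copy_sub cL clL' clt clu tu).
move=> _ cc c_inj share nocommon.
(* The list is [c k, ..., c 1]; for [k = l.-1] it holds every member of the cycle except [c 0]. *)
pose rest k := iteri k (fun i s => c i.+1 :: s) [::].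
have restP k K : reflect (exists2 i, (i < k)%N & K = c i.+1) (K \in rest k).
  elim: k K => [|k IHk] K /=; first by apply: ReflectF => -[].
  rewrite inE; apply: (iffP orP) => [[/eqP->|/IHk[i ik ->]]|[i]].
  - by exists k.
  - by exists i => //; exact: ltnW.
  - rewrite ltnS leq_eqVlt => /orP[/eqP->|ik] ->; first by left.
    by right; apply/IHk; exists i.
have tw k : (k < l)%N -> tower (rest k).
  elim: k => [//|k IHk] kl; have ck := cc _ kl.
  case: k IHk kl ck => [|k] IHk kl ck; first by [].
  split=> //; split; first exact/IHk/ltnW.
  have [C /closed_copy1[t clt ->]] := share _ (ltnW kl).
  rewrite modn_small // fsub1set inE => /andP[tk tk1]; exists t; split=> //.
  by rewrite /= inE tk.
have l1 : (l.-1 < l)%N by lia.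
have [C clC C0] := share 0%N (ltnW l2).
have [C' clC' Cl] := share l.-1 l1.
(* These are the two intersections involving [c 0]; their closed points coincide, against the last
   clause of a cycle. *)
case: (nocommon 0%N l.-1 (ltnW l2) l1); first lia.
have [t clt CE] := closed_copy1 clC; have [u clu C'E] := closed_copy1 clC'.
exists C; split=> //; suff -> : C = C' by [].
move: C0 Cl; rewrite CE C'E prednK; last lia.
rewrite modnn modn_small // !fsub1set !inE => /andP[t0 t1] /andP[ul u0].
congr ([fset _]); apply: (tower_inter (tw _ l1) (cc _ (ltnW l2))) => //.
- apply/restP => -[i il] /c_inj; lia.
- by apply/spanP; exists (c 1%N) => //; apply/restP; exists 0%N => //; lia.
- apply/spanP; exists (c l.-1) => //; apply/restP; exists l.-2; first lia.
  by rewrite prednK //; lia.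
Qed.

Lemma card_binom_point v : (binom (induced B [fset v]) B #= `I_6)%card.
Proof.
pose g k : {ffun [fset v] -> V} := [ffun=> pts (inord k)].
have g_inj : {in `I_6 &, injective g}.
  move=> i j; rewrite !inE => i6 j6 /ffunP/(_ [` fset11 v]).
  by rewrite !ffunE => /pts_inj/(congr1 val); rewrite /= !inordK.
suff -> : binom (induced B [fset v]) B = (g @` `I_6)%classic.
  exact: inj_card_eq.
apply/seteqP; split=> h /=.
  move/binom_point/closed_in1/codomP => [i hE]; exists i; first exact: ltn_ord.
  by apply/ffunP=> x; rewrite ffunE inord_val (fset1_sub_eq x).
move=> [k _ <-]; apply/binom_point/closed_in1.
by rewrite ffunE; exact: pts_good.
Qed.

(** * Colourings with at most one error on each copy *)

Section Colouring.
Variable target : pred V.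

Definition one_error (f : T -> bool) L := forall x y, good x -> good y ->
  f (L x) <> target x -> f (L y) <> target y -> x = y.

(** Induction by removing a leaf [L]: the other copies keep their colouring, and the points of [L]
    on no other copy follow [target]. An error on [L] can then occur only at its one shared closed
    point. *)
Lemma finite_colouring (F : seq {ffun V -> T}) :
  (forall L, L \in F -> copy L) ->
  exists f, forall L, L \in F -> one_error f L.
Proof.
have [n] := ubnP (size F); elim: n F => // n IHn F sz cF.
have [->|F0] := eqVneq F [::]; first by exists xpredT.
have [L LF leaf] := exists_leaf cF F0.
pose F' := [seq K <- F | K != L].
have lt_F : (size F' < size F)%N.
  rewrite size_filter -(count_predC (pred1 L) F).
  by rewrite -[X in (X < _)%N]add0n ltn_add2r -has_count has_pred1.
have [||f fok] := IHn F'; first exact: leq_trans lt_F _.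
  by move=> K; rewrite mem_filter => /andP[_ /cF].
pose fresh t := (t \in img L) && ~~ has (fun K => t \in img K) F'.
exists (fun t => if fresh t then [exists x, (L x == t) && target x] else f t).
move=> K KF; have [->|KL] := eqVneq K L; last first.
  have KF' : K \in F' by rewrite mem_filter KL.
  have fr x : fresh (K x) = false.
    by apply/negP => /andP[_ /hasP[]]; exists K => //; exact: mem_img.
  by move=> x y gx gy; rewrite !fr; exact: fok.
have cL := cF _ LF; have [[injL _] _] := cL.
have old x : (if fresh (L x) then [exists z, (L z == L x) && target z]
    else f (L x)) <> target x ->
    exists K, [/\ K \in F, K != L & L x \in img K].
  case: ifP => [_ []|]; last first.
    rewrite /fresh mem_img /= => /negbT; rewrite negbK => /hasP[K'].
    by rewrite mem_filter => /andP[] *; exists K'.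
  apply/existsP/idP => [[z /andP[/eqP/injL->]]|tx] //.
  by exists x; rewrite eqxx.
move=> x y gx gy /old[K1 [K1F nK1 xK1]] /old[K2 [K2F nK2 yK2]]; apply: injL.
apply: (leaf _ _ K1 K2) => //; rewrite ?mem_img //; exact/(copy_closedpt _ cL).
Qed.

(* The ultrafilter replaces a compactness argument: f is the limit of colourings
   of the finite sets of copies with code below n. *)
Lemma colouring : exists f, forall L, copy L -> one_error f L.
Proof.
pose F n := [seq L <- pmap choice.unpickle (iota 0 n) | `[< copy L >]].
have FP n L : L \in F n -> copy L by rewrite mem_filter => /andP[/asboolP].
have [f fok] : {f : nat -> T -> bool &
    forall n L, L \in F n -> one_error (f n) L}.
  apply: (@choice _ _ (fun n f => forall L, L \in F n -> one_error f L)) => n.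
  exact: finite_colouring (FP n).
have [G [Gultra leG]] := ultraFilterLemma eventually_filter.
pose lf t := `[< G [set n | f n t]%classic >].
have agree t : G [set n | f n t = lf t]%classic.
  rewrite /lf; have [Gt|nGt] := pselect (G [set n | f n t]%classic).
    by rewrite asboolT.
  have [//|Gc] := in_ultra_setVsetC [set n | f n t]%classic Gultra.
  by rewrite asboolF //; apply: filterS Gc => n /= /negP/negPf.
exists lf => L cL x y gx gy ex ey.
have GL : G [set n | L \in F n]%classic.
  apply: leG; exists (choice.pickle L).+1 => // n /= lt_n.
  rewrite mem_filter; apply/andP; split; first exact/asboolP.
  rewrite mem_pmap; apply/mapP; exists (choice.pickle L).
    by rewrite mem_iota.
  by rewrite choice.pickleK.
(* Only the colours at two points matter, so a single index [n] agreeing with the limit there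
   suffices. *)
have [n [[/= LF ax] ay]] :=
  filter_ex (filterI (filterI GL (agree (L x))) (agree (L y))).
by apply: (fok _ _ LF _ _ gx gy); rewrite ?ax ?ay.
Qed.
End Colouring.

(** * Failure of the convex Ramsey property *)

Lemma not_convex_ramsey (R : realType) v :
  K0 B -> good v -> ~ convex_ramsey R M.
Proof.
move=> KB gv CR.
pose target x := [exists i : 'I_(3 + 3), (i < 3)%N && (pts i == x)].
have targetE i : target (pts i) = (i < 3)%N.
  apply/existsP/idP => [[j /andP[j3 /eqP/pts_inj<-]]|i3] //.
  by exists i; rewrite i3 eqxx.
have [f fok] := colouring target.
pose v0 : [fset v] := [` fset11 v].
have [p pB bd] := CR V B [fset v] (K0_induced KB) KB ((closed_in1 v).2 gv)
  (fun g : {ffun [fset v] -> T} => f (g v0)).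
pose F i : R := \sum_(L <- finsupp p) (f (L (pts i)))%:R * p L.
have F_bd i j : F i - F j <= 2^-1.
  have q_ k : exists2 q, submeas M (induced B [fset v]) B p q &
      expect (fun g : {ffun [fset v] -> T} => f (g v0)) q = F k.
    have gB : binom (induced B [fset v]) B [ffun=> pts k].
      by apply/binom_point/closed_in1; rewrite ffunE; exact: pts_good.
    have [q qs qE] := submeas_dirac pB gB; exists q => //.
    rewrite qE; apply: eq_bigr => L _; by rewrite !ffunE.
  have [q1 q1s <-] := q_ i; have [q2 q2s <-] := q_ j.
  by rewrite -[leRHS]mul1r; exact: le_trans (ler_norm _) (bd _ _ q1s q2s).
pose sgn (i : 'I_(3 + 3)) : R := if (i < 3)%N then 1 else -1.
(* Pairing [i] with [i + 3] gives three differences, each at most one half. *)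
have : \sum_i sgn i * F i <= 3 / 2.
  rewrite big_split_ord /= -big_split /=.
  apply: (@le_trans _ _ (\sum_(i < 3) (2^-1 : R))).
    apply: ler_sum => i _; rewrite /sgn /= ltn_ord mul1r mulN1r; exact: F_bd.
  by rewrite sumr_const card_ord -mulr_natr; lra.
suff : 2 <= \sum_i sgn i * F i by lra.
have [pcopy p_ge0 p_sum] := pB.
have -> : \sum_i sgn i * F i =
    \sum_(L <- finsupp p) (\sum_i sgn i * (f (L (pts i)))%:R) * p L.
  under eq_bigr do rewrite mulr_sumr.
  rewrite exchange_big /=; apply: eq_bigr => L _; rewrite mulr_suml.
  by apply: eq_bigr => i _; rewrite mulrA.
apply: (@le_trans _ _ (\sum_(L <- finsupp p) 2 * p L)).
  by rewrite -mulr_sumr p_sum mulr1.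
rewrite big_seq [leRHS]big_seq.
apply: ler_sum => L Lp; apply: ler_wpM2r => //.
have {}fok := fok L (pcopy _ Lp).
pose err i := f (L (pts i)) != (i < 3)%N.
(* Without errors the signed sum is 3, and each error costs exactly 1 on either half; with at most
   one error at least 2 remains. *)
apply: (@le_trans _ _ (\sum_(i < 3 + 3) ((i < 3)%N%:R - (err i)%:R))).
  2: {
  apply: ler_sum => i _; rewrite /sgn /err.
  by case: ifP; case: (f _) => /=; lra. }
have le1 : (#|err| <= 1)%N.
  apply/card_le1_eqP => i j /negP ei /negP ej; apply: pts_inj.
  by apply: fok => //; rewrite targetE => /eqP.
rewrite sumrB -!natr_sum.
have -> : (\sum_(i < 3 + 3) (i < 3) = 3)%N by rewrite !big_ord_recl big_ord0.
have -> : (\sum_(i < 3 + 3) err i = #|err|)%N.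
  by rewrite -sum1_card [RHS]big_mkcond; apply: eq_bigr => i _;
    rewrite -topredE /=; case: (err i).
by move: le1; case: #|err| => [|[]] // _; lra.
Qed.

End PointTrees.

(** * The 11-vertex graph *)

Section EdgeList.
Variables (n : nat) (E : seq (nat * nat)).
Hypothesis E_lt : all (fun e => e.1 < e.2 < n.+1)%N E.

Definition list_adj (i j : nat) := ((i, j) \in E) || ((j, i) \in E).

Lemma list_adj_sym : symmetric (fun i j : 'I_n.+1 => list_adj i j).
Proof. by move=> i j; rewrite /list_adj orbC. Qed.

Lemma list_adj_irr : irreflexive (fun i j : 'I_n.+1 => list_adj i j).
Proof.
move=> i; apply/negP; rewrite /list_adj orbb => /(allP E_lt) /=.
by rewrite ltnn.
Qed.

Definition list_graph : sgraph 'I_n.+1 := SGraph list_adj_sym list_adj_irr.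

(** * Backtracking search for automorphisms *)

Definition auto_extensions k (s : seq nat) : seq nat :=
  [seq v <- iota 0 n.+1 | (v \notin s) &&
     all (fun i => list_adj (nth 0%N s i) v == list_adj i k) (iota 0 k)].

(** A sequence of length [k] lists the images of the vertices [0, ..., k - 1] under a partial
    embedding. *)
Fixpoint partial_autos k : seq (seq nat) :=
  if k is k'.+1 then
    [seq rcons s v | s <- partial_autos k', v <- auto_extensions k' s]
  else [:: [::]].

Lemma mem_partial_autos (s : {ffun 'I_n.+1 -> 'I_n.+1}) k :
  embedding list_graph list_graph s -> (k <= n.+1)%N ->
  mkseq (fun i => val (s (inord i))) k \in partial_autos k.
Proof.
case=> s_inj sE; elim: k => // k IHk kn; rewrite mkseqS /=.
apply/allpairsPdep; exists (mkseq (fun i => val (s (inord i))) k).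
exists (val (s (inord k))); split=> //; first exact/IHk/ltnW.
rewrite mem_filter mem_iota /= add0n ltn_ord andbT; apply/andP; split.
  apply/mapP => -[i]; rewrite mem_iota add0n /= => ik.
  move=> /val_inj/s_inj/(congr1 val); rewrite /= !inordK; lia.
apply/allP => i; rewrite mem_iota add0n /= => ik; rewrite nth_mkseq //.
apply/eqP; have := sE (inord i) (inord k); rewrite /= !inordK //; lia.
Qed.

(** * Computing predimensions on bit sequences *)

Definition bits (S : {fset 'I_n.+1}) : bitseq :=
  mkseq (fun k => inord k \in S) n.+1.

Definition edge_count (b : bitseq) :=
  count (fun e => nth false b e.1 && nth false b e.2) E.

Lemma nth_bits S (x : 'I_n.+1) : nth false (bits S) x = (x \in S).
Proof. by rewrite nth_mkseq // inord_val. Qed.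

Lemma card_bits S : #|` S| = count id (bits S).
Proof.
rewrite /bits /mkseq count_map -size_filter.
have -> : iota 0 n.+1 = map val (enum 'I_n.+1) by rewrite val_enum_ord.
rewrite filter_map size_map; apply: perm_size; apply: uniq_perm.
- exact: fset_uniq.
- exact/filter_uniq/enum_uniq.
by move=> x; rewrite mem_filter /= mem_enum andbT inord_val.
Qed.

Fixpoint bitseqs k : seq bitseq :=
  if k is k'.+1 then
    map (cons true) (bitseqs k') ++ map (cons false) (bitseqs k')
  else [:: [::]].

Lemma mem_bitseqs b : b \in bitseqs (size b).
Proof.
elim: b => //= c b IHb; rewrite mem_cat; apply/orP.
by case: c; [left|right]; apply: map_f.
Qed.

Lemma bits_all (P : pred bitseq) S : all P (bitseqs n.+1) -> P (bits S).
Proof.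
move/allP; apply.
by rewrite -[n.+1](size_mkseq (fun k => inord k \in S)) mem_bitseqs.
Qed.

Hypothesis E_uniq : uniq E.

(** Each undirected edge is listed once, with its smaller end first, so passing from ordered pairs
    to two-element sets is injective. *)
Lemma card_edges_bits S : #|` edges list_graph S| = edge_count (bits S).
Proof.
rewrite /edge_count -size_filter.
pose pair e : {fset 'I_n.+1} := [fset inord e.1; inord e.2].
rewrite -(size_map pair); apply: perm_size; apply: uniq_perm.
- exact: fset_uniq.
- rewrite map_inj_in_uniq ?filter_uniq // => -[a b] [c d].
  rewrite !mem_filter => /andP[_ /(allP E_lt)/= ab] /andP[_ /(allP E_lt)/= cd].
  move=> /fsetP pE; have := (pE (inord a), pE (inord b)).
  rewrite !inE !eqxx !orbT /= -!val_eqE /= !inordK; try lia.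
  by move=> [/esym/orP[]/eqP ? /esym/orP[]/eqP ?]; congr (_, _); lia.
move=> e; apply/edgesP/mapP => [[x [y [xS yS xy ->]]]|[[a b]]].
  by case/orP: xy => xy; [exists (val x, val y)|exists (val y, val x)];
    rewrite ?mem_filter /= ?xy ?nth_bits ?xS ?yS // /pair !inord_val // fsetUC.
rewrite mem_filter /= => /andP[/andP[aS bS] abE] ->.
exists (inord a), (inord b).
have /= ab := allP E_lt _ abE.
rewrite -!nth_bits /= /list_adj !inordK; try lia.
by rewrite abE.
Qed.

Lemma delta_bits S : delta list_graph S =
  (2 * count id (bits S))%:Z - (edge_count (bits S))%:Z.
Proof. by rewrite /delta card_bits card_edges_bits. Qed.

End EdgeList.

(* The vertices 6, ..., 10 carry K_5 minus the edge 67, whose predimension is 1;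
   hence the closed points are exactly 0, ..., 5. *)
Definition witness_edges : seq (nat * nat) :=
  [:: (0, 1); (0, 3); (0, 5); (1, 4); (2, 3); (2, 4); (3, 4); (4, 5);
      (1, 6); (2, 10); (5, 9);
      (6, 8); (6, 9); (6, 10); (7, 8); (7, 9); (7, 10); (8, 9); (8, 10);
      (9, 10)]%N.

Lemma witness_lt : all (fun e => e.1 < e.2 < 11)%N witness_edges.
Proof. by []. Qed.

Definition witness : sgraph 'I_11 := list_graph witness_lt.

(** * Predimension and rigidity of the witness *)

Definition closed_points (i : 'I_(3 + 3)) : 'I_11 := inord i.

Lemma val_closed_points i : val (closed_points i) = i.
Proof. by rewrite /= inordK //; exact: leq_trans (ltn_ord i) _. Qed.

Lemma closed_points_inj : injective closed_points.
Proof.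
by move=> i j /(congr1 val); rewrite !val_closed_points; exact: val_inj.
Qed.

Lemma closed_pointsE x : (x \in codom closed_points) = (x < 6)%N.
Proof.
apply/codomP/idP => [[i ->]|x6]; first by rewrite val_closed_points ltn_ord.
by exists (Ordinal x6); apply: val_inj; rewrite val_closed_points.
Qed.

(** The three conjuncts encode membership in [K0], the bound 2 for sets with a closed point, and the
    strict bound for proper subsets with two. Additions on the left avoid truncated subtraction. *)
Definition witness_ok (b : bitseq) : bool :=
  let e := edge_count witness_edges b in
  let d := (2 * count id b)%N in
  [&& (e <= d)%N,
      all (fun x => nth false b x ==> (e + 2 <= d)%N) (iota 0 6)
    & all (fun x => all (fun y => [&& nth false b x, nth false b y & x != y] ==>
        (all id b || (e + 3 <= d)%N)) (iota 0 6)) (iota 0 6)].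

(** An exhaustive computation over the [2^11] vertex subsets. *)
Lemma witness_check (S : {fset 'I_11}) : witness_ok (bits S).
Proof. by apply: bits_all; vm_compute. Qed.

Lemma witness_K0 : K0 witness.
Proof.
by move=> S; have /and3P[+ _ _] := witness_check S; rewrite delta_bits //; lia.
Qed.

Lemma witness_delta_ge2 (S : {fset 'I_11}) x :
  x \in S -> x \in codom closed_points -> 2 <= delta witness S.
Proof.
rewrite closed_pointsE => xS x6.
have xI : val x \in iota 0 6 by rewrite mem_iota.
have /and3P[_ /allP/(_ _ xI) + _] := witness_check S.
by rewrite nth_bits xS implyTb delta_bits //; lia.
Qed.

Lemma witness_delta_gt2 (S : {fset 'I_11}) x y : x \in S -> y \in S ->
  x \in codom closed_points -> y \in codom closed_points -> x != y ->
  (forall z, z \in S) \/ 2 < delta witness S.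
Proof.
rewrite !closed_pointsE => xS yS x6 y6 xy.
have [xI yI] : val x \in iota 0 6 /\ val y \in iota 0 6 by rewrite !mem_iota.
have /and3P[_ _ /allP/(_ _ xI)/allP/(_ _ yI)] := witness_check S.
rewrite !nth_bits xS yS val_eqE xy implyTb delta_bits // => /orP[allS|].
  2: by right; lia.
left=> z; rewrite -nth_bits; apply: (allP allS); rewrite mem_nth // size_mkseq.
Qed.

Lemma witness_delta_lt2 x : x \notin codom closed_points ->
  exists2 S : {fset 'I_11}, x \in S & delta witness S < 2.
Proof.
rewrite closed_pointsE -leqNgt => x6; exists [fset y : 'I_11 | (6 <= y)%N].
  by rewrite !inE.
rewrite delta_bits //.
have -> : bits [fset y : 'I_11 | (6 <= y)%N] = mkseq (fun k => 6 <= k)%N 11.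
  by apply/eq_in_map => k; rewrite mem_iota !inE /= => k11; rewrite inordK.
by vm_compute.
Qed.

Lemma witness_delta_full : delta witness [fset x | x : 'I_11] = 2.
Proof.
rewrite delta_bits //.
have -> : bits [fset x | x : 'I_11] = nseq 11 true.
  by rewrite -[nseq _ _]/(mkseq xpredT 11); apply: eq_map => k; rewrite !inE.
by vm_compute.
Qed.

Lemma witness_rigid s : embedding witness witness s -> s =1 id.
Proof.
move=> se; have := mem_partial_autos se (leqnn _).
(* The search leaves only the identity. *)
have -> : partial_autos 10 witness_edges 11 = [:: iota 0 11] by vm_compute.
rewrite inE => /eqP sE x; apply: val_inj.
have := congr1 (fun t => nth 0%N t x) sE.
by rewrite nth_mkseq // nth_iota // inord_val.
Qed.

Theorem theorem4p3 (R : realType) (T : countType) (M : sgraph T)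
    (M_generic : generic M) :
  (exists (V : finType) (B : sgraph V) (A : {fset V}),
     [/\ K0 (induced B A), K0 B, closed_in B A,
         (binom (induced B A) B #= `I_6)%card
       & tree_pair M (induced B A) B])
  /\ ~ convex_ramsey R M.
Proof.
pose v := closed_points ord0.
have gv : v \in codom closed_points by exact: codom_f.
split; last first.
  exact: (not_convex_ramsey closed_points_inj witness_delta_full
    witness_delta_ge2 witness_delta_gt2 witness_delta_lt2 witness_rigid
    witness_K0 gv).
exists 'I_11, witness, [fset v]; split.
- exact: (K0_induced witness_K0).
- exact: witness_K0.
- exact/(closed_in1 witness_delta_ge2 witness_delta_lt2).
- exact: (card_binom_point closed_points_inj witness_delta_ge2
    witness_delta_lt2).
- exact: (point_tree_pair closed_points_inj witness_delta_full
    witness_delta_ge2 witness_delta_gt2 witness_delta_lt2 witness_rigid).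
Qed.
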